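(* Let $\mathcal S=\{S_1,\dots,S_m\}$ and $\mathcal S'=\{S'_1,\dots,S'_m\}$ be self-similar Jordan zippers in $\mathbb R^n$ with attractors $\gamma$ and $\gamma'$, signatures $\bm\varepsilon,\bm\varepsilon'\in\{0,1\}^m$, and similarity coefficients $\operatorname{Lip}S_i$, $\operatorname{Lip}S'_i$, $i\in J=\{1,\dots,m\}$, respectively. 1. If $\bm\varepsilon=\bm\varepsilon'$, $\operatorname{Lip}S_i=\operatorname{Lip}S'_i$ for every $i\in J$, and $\gamma$ and $\gamma'$ are arcs of bounded turning, then $\mathcal S$ and $\mathcal S'$ are bi-Lipschitz isomorphic. 2. If $\mathcal S$ and $\mathcal S'$ are bi-Lipschitz isomorphic and $\gamma$ is an arc of bounded turning, then $\bm\varepsilon=\bm\varepsilon'$, $\operatorname{Lip}S_i=\operatorname{Lip}S'_i$ for every $i\in J$, and $\gamma'$ is an arc of bounded turning.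
   Context: A system $\mathcal S=\{S_i,\ i\in J\}$, $J=\{1,\dots,m\}$, of contracting similarities of $\mathbb R^n$ (ratios in $(0,1)$) is a self-similar zipper with vertices $\{z_0,\dots,z_m\}\subset\mathbb R^n$ and signature $\bm\varepsilon=(\varepsilon_1,\dots,\varepsilon_m)\in\{0,1\}^m$ if for every $i\in J$, $S_i(z_0)=z_{i-1+\varepsilon_i}$ and $S_i(z_m)=z_{i-\varepsilon_i}$. Its attractor is the (unique nonempty) compact set $K=K(\mathcal S)$ with $K=S_1(K)\cup\dots\cup S_m(K)$. $\operatorname{Lip}S_i$ denotes the similarity ratio of $S_i$. If $0=t_0<t_1<\dots<t_m=1$, a self-similar zipper $\mathcal T=\{T_1,\dots,T_m\}$ in $\mathbb R$ with vertices $\{t_0,\dots,t_m\}$ and some signature is called linear; its attractor is $I=[0,1]$. For any zipper $\mathcal S$ with vertices $\{z_0,\dots,z_m\}$ and any linear zipper $\mathcal T$ with the same signature, there is a unique continuous map $g:I\to K(\mathcal S)$ with $g(t_i)=z_i$ for all $i$ and $S_i\circ g=g\circ T_i$ for every $i\in J$; moreover $g(I)=K(\mathcal S)$. Such maps $g$ are called structural parametrizations of the attractor. $\mathcal S$ is a Jordan zipper if one (equivalently, any) structural parametrization is a homeomorphism of $I$ onto $K(\mathcal S)$. A Jordan arc $\gamma\subset\mathbb R^n$ is an arc of bounded turning if there is $M>0$ such that for any $x,y\in\gamma$ the diameter of the subarc $\gamma_{xy}\subset\gamma$ with endpoints $x,y$ is at most $M\|x-y\|$. For self-similar Jordan zippers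 $\mathcal S=\{S_i,\ i\in J\}$ and $\mathcal S'=\{S'_i,\ i\in J\}$ with attractors $\gamma,\gamma'$, a homeomorphism $f:\gamma\to\gamma'$ agrees with $\mathcal S$ and $\mathcal S'$ if $f\circ S_i=S'_i\circ f$ on $\gamma$ for every $i\in J$; then $f$ is said to define an isomorphism of the zippers. The zippers $\mathcal S$ and $\mathcal S'$ are bi-Lipschitz isomorphic if there is a homeomorphism $f$ agreeing with $\mathcal S$ and $\mathcal S'$ that is bi-Lipschitz, i.e. both $f$ and $f^{-1}$ are Lipschitz. *)

(* Defs.v *)
From HB Require Import structures.
From mathcomp Require Import all_boot all_order all_algebra.
From mathcomp Require Import all_classical all_reals all_analysis.

Set Implicit Arguments.
Unset Strict Implicit.
Unset Printing Implicit Defensive.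

Import Order.TTheory GRing.Theory Num.Theory.
Import numFieldNormedType.Exports.

Local Open Scope classical_set_scope.
Local Open Scope ring_scope.

(* The library's norm on 'rV[R]_n is the sup norm, for which similarities are
   different maps; it induces the same topology as edist, so topological
   notions below (compact, continuous) are the library's. *)
Definition edist (R : realType) (n : nat) (x y : 'rV[R]_n) : R :=
  Num.sqrt (\sum_(i < n) (x ord0 i - y ord0 i) ^+ 2).

Definition rdist (R : realType) (x y : R) : R := `|x - y|.

Definition unit_itv (R : realType) : set R := `[0, 1]%classic.

Definition similarity (R : realType) (T : Type) (d : T -> T -> R) (r : R)
    (F : T -> T) : Prop :=
  forall x y, d (F x) (F y) = r * d x y.

(* Self-similar zippers in the space (T, d).  The index set {1, ..., m} is
   'I_m, shifted by one: the i-th map sends the first vertex to z_(i + eps_i)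
   and the last one to z_(i + 1 - eps_i), with eps_i coerced to {0, 1}. *)
Record zipper (R : realType) (T : Type) (d : T -> T -> R) (m : nat) :=
  Zipper {
    zmap : 'I_m -> T -> T;
    Lip : 'I_m -> R;
    vertex : 'I_m.+1 -> T;
    signature : {ffun 'I_m -> bool};
    Lip_itv : forall i, 0 < Lip i < 1;
    zmap_similarity : forall i, similarity d (Lip i) (zmap i);
    zmap_first : forall i,
      zmap i (vertex ord0) = vertex (inord (i + signature i));
    zmap_last : forall i,
      zmap i (vertex ord_max) = vertex (inord (i.+1 - signature i))
  }.

Definition zipper_Rn (R : realType) (n m : nat) := zipper (@edist R n) m.

Definition is_attractor (R : realType) (n m : nat) (S : zipper_Rn R n m)
    (K : set 'rV[R]_n) : Prop :=
  [/\ K !=set0, compact K & K = \bigcup_(i in [set: 'I_m]) (zmap S i @` K)].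

Definition is_linear (R : realType) (m : nat) (T : zipper (@rdist R) m) : Prop :=
  [/\ vertex T ord0 = 0, vertex T ord_max = 1
    & forall i j : 'I_m.+1, (i < j)%N -> vertex T i < vertex T j].

(* f restricts to a homeomorphism of A onto B whose inverse is the restriction
   of h to B; the values of f off A and of h off B are irrelevant. *)
Definition inverse_homeomorphisms (U V : topologicalType)
    (A : set U) (B : set V) (f : U -> V) (h : V -> U) : Prop :=
  [/\ set_fun A B f, set_fun B A h,
      (forall x, A x -> h (f x) = x) /\ (forall y, B y -> f (h y) = y),
      {within A, continuous f} & {within B, continuous h}].

Definition homeomorphism (U V : topologicalType)
    (A : set U) (B : set V) (f : U -> V) : Prop :=
  exists h : V -> U, inverse_homeomorphisms A B f h.

Definition structural_parametrization (R : realType) (n m : nat)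
    (S : zipper_Rn R n m) (K : set 'rV[R]_n) (T : zipper (@rdist R) m)
    (g : R -> 'rV[R]_n) : Prop :=
  [/\ set_fun (@unit_itv R) K g,
      {within @unit_itv R, continuous g},
      forall i, g (vertex T i) = vertex S i
    & forall i x, unit_itv x -> zmap S i (g x) = g (zmap T i x)].

Definition is_Jordan (R : realType) (n m : nat) (S : zipper_Rn R n m)
    (K : set 'rV[R]_n) : Prop :=
  exists (T : zipper (@rdist R) m) (g : R -> 'rV[R]_n),
    [/\ is_linear T, signature T = signature S,
        structural_parametrization S K T g
      & homeomorphism (@unit_itv R) K g].

(* Only applied to bounded sets (on unbounded ones, sup is 0). *)
Definition diameter (R : realType) (n : nat) (A : set 'rV[R]_n) : R :=
  sup [set d | exists x y, [/\ A x, A y & d = edist x y]].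

Definition Jordan_arc (R : realType) (n : nat) (A : set 'rV[R]_n) : Prop :=
  exists phi : R -> 'rV[R]_n, homeomorphism (@unit_itv R) A phi.

(* B is the subarc of A with endpoints x and y.  It does not depend on phi, and
   s <= t is no restriction since phi may be reversed; B = [set x] if x = y. *)
Definition subarc (R : realType) (n : nat) (A : set 'rV[R]_n)
    (x y : 'rV[R]_n) (B : set 'rV[R]_n) : Prop :=
  exists (phi : R -> 'rV[R]_n) (s t : R),
    [/\ homeomorphism (@unit_itv R) A phi, 0 <= s <= t /\ t <= 1,
        phi s = x, phi t = y & B = phi @` `[s, t]].

Definition bounded_turning (R : realType) (n : nat) (A : set 'rV[R]_n) : Prop :=
  Jordan_arc A /\
  exists2 M : R, 0 < M &
    forall x y B, A x -> A y -> subarc A x y B -> diameter B <= M * edist x y.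

Definition lipschitz_over (R : realType) (n : nat) (A : set 'rV[R]_n)
    (f : 'rV[R]_n -> 'rV[R]_n) : Prop :=
  exists L : R, forall x y, A x -> A y -> edist (f x) (f y) <= L * edist x y.

Definition agrees (R : realType) (n m : nat) (S S' : zipper_Rn R n m)
    (K : set 'rV[R]_n) (f : 'rV[R]_n -> 'rV[R]_n) : Prop :=
  forall i x, K x -> f (zmap S i x) = zmap S' i (f x).

Definition bilipschitz_isomorphic (R : realType) (n m : nat)
    (S S' : zipper_Rn R n m) (K K' : set 'rV[R]_n) : Prop :=
  exists f h : 'rV[R]_n -> 'rV[R]_n,
    [/\ inverse_homeomorphisms K K' f h, agrees S S' K f,
        lipschitz_over K f & lipschitz_over K' h].

(* Main.v *)
Require Import Defs.
From HB Require Import structures.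
From mathcomp Require Import all_boot all_order all_algebra.
From mathcomp Require Import all_classical all_reals all_analysis.
From mathcomp Require Import ring lra zify.
(* Imported last: the analysis library has another function called edist. *)
Import Defs.

Set Implicit Arguments.
Unset Strict Implicit.
Unset Printing Implicit Defensive.

Import Order.TTheory GRing.Theory Num.Theory.
Import numFieldNormedType.Exports.

Local Open Scope classical_set_scope.
Local Open Scope ring_scope.

(** Both attractors are coded by infinite words over the alphabet J, and the
only candidate for an isomorphism sends the point of gamma with a given address
to the point of gamma' with the same address.  The proof works with finite
approximations of this correspondence: [same_word k x y] says that some word w
of length k satisfies x \in S_w(gamma) and y \in S'_w(gamma').

For part 1 everything rests on one estimate ([separation_estimate]): if x1, y1
share a word of length k, and x2, y2 share a word of length k, then
|x1 - x2| <= C |y1 - y2| + E rho^k.  Since the ratios agree, a common prefix of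
the two words scales both sides equally, so only words with distinct first
letters i < j matter.  If the pieces i and j are not consecutive, bounded
turning of gamma' keeps their images in gamma' apart, and the diameter of gamma
bounds the left-hand side.  If j = i + 1, the path from y1 to y2 passes through
the common vertex of the two pieces, so by bounded turning it is enough to
compare distances to that vertex, which is the image of an endpoint of the
arc.  An endpoint is in turn the image of an endpoint by the first or last map,
and induction on k finishes the comparison ([endpoint_estimate]).

The estimate makes the correspondence single-valued and Lipschitz; exchanging
the two zippers gives the inverse ([bilipschitz_of_comparable]).  The
two linear zippers may have different division points.

For part 2, let f be a bi-Lipschitz isomorphism.  Iterating S_i k times
multiplies a distance by Lip S_i ^ k, and f turns this into Lip S'_i ^ k; a
Lipschitz f forces Lip S'_i <= Lip S_i, and symmetrically
([lipschitz_agrees_Lip_le]).  For the signatures, the reparametrization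
phi = g'^-1 o f o g of [0, 1] conjugates the linear zippers and maps the first
piece into the first and the last into the last, hence it is increasing; and
the orientation of a linear T_i, which is its signature, is invariant under
increasing conjugacies ([conjugate_signature]).  Bounded turning is a
bi-Lipschitz invariant ([bilipschitz_bounded_turning]). *)

(** * The Euclidean distance *)

Section EuclideanDistance.
Context {R : realType} {n : nat}.
Implicit Types (x y z : 'rV[R]_n) (A : set 'rV[R]_n).

Lemma edist_ge0 x y : 0 <= edist x y.
Proof. exact: sqrtr_ge0. Qed.

Lemma edistxx x : edist x x = 0.
Proof. by rewrite /edist big1 ?sqrtr0// => i _; rewrite subrr expr0n. Qed.

Lemma edistC x y : edist x y = edist y x.
Proof. by congr Num.sqrt; apply: eq_bigr => i _; ring. Qed.

Lemma sum_sqr_ge0 (a : 'I_n -> R) : 0 <= \sum_i a i ^+ 2.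
Proof. by apply: sumr_ge0 => i _; exact: sqr_ge0. Qed.

Lemma cauchy_schwarz (a b : 'I_n -> R) :
  (\sum_i a i * b i) ^+ 2 <= (\sum_i a i ^+ 2) * (\sum_i b i ^+ 2).
Proof.
set A := \sum_i a i ^+ 2; set B := \sum_i b i ^+ 2; set C := \sum_i _.
have : 0 <= B * (A * B - C ^+ 2).
  (* B a - C b is B times the component of a orthogonal to b. *)
  have -> : B * (A * B - C ^+ 2) = \sum_i (B * a i - C * b i) ^+ 2.
    rewrite (eq_bigr (fun i => B ^+ 2 * a i ^+ 2 - 2 * (B * C) * (a i * b i)
                               + C ^+ 2 * b i ^+ 2)); last by move=> i _; ring.
    by rewrite big_split sumrB -!mulr_sumr -/A -/B -/C /=; ring.
  exact: sum_sqr_ge0.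
have [Bpos|Bneg] := ltP 0 B; first by rewrite pmulr_rge0// subr_ge0.
have B0 : B = 0 by apply/eqP; rewrite eq_le Bneg sum_sqr_ge0.
suff -> : C = 0 by rewrite expr0n B0 mulr0.
apply: big1 => i _; have := psumr_eq0P (fun j _ => sqr_ge0 (b j)) B0 (i := i).
by move=> /(_ isT)/eqP; rewrite sqrf_eq0 => /eqP ->; rewrite mulr0.
Qed.

(** Minkowski's inequality, squared and reduced to Cauchy-Schwarz. *)
Lemma edist_triangle y x z : edist x z <= edist x y + edist y z.
Proof.
pose a i := x ord0 i - y ord0 i; pose b i := y ord0 i - z ord0 i.
have -> : edist x z = Num.sqrt (\sum_i (a i + b i) ^+ 2).
  by congr Num.sqrt; apply: eq_bigr => i _; rewrite /a /b; ring.
set A := edist x y; set B := edist y z.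
have AE : A ^+ 2 = \sum_i a i ^+ 2 by rewrite sqr_sqrtr// sum_sqr_ge0.
have BE : B ^+ 2 = \sum_i b i ^+ 2 by rewrite sqr_sqrtr// sum_sqr_ge0.
have A0 : 0 <= A := edist_ge0 _ _; have B0 : 0 <= B := edist_ge0 _ _.
rewrite -(ler_pXn2r (n := 2)) ?nnegrE ?sqrtr_ge0 ?addr_ge0// sqr_sqrtr ?sum_sqr_ge0//.
have -> : \sum_i (a i + b i) ^+ 2 = A ^+ 2 + 2 * (\sum_i a i * b i) + B ^+ 2.
  rewrite AE BE mulr_sumr -!big_split /=.
  by apply: eq_bigr => i _; ring.
suff : \sum_i a i * b i <= A * B by move=> ?; lra.
apply: le_trans (ler_norm _) _.
rewrite -(ler_pXn2r (n := 2)) ?nnegrE ?mulr_ge0// real_normK ?num_real//.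
by rewrite exprMn AE BE cauchy_schwarz.
Qed.

Lemma coord_le_norm x i : `|x ord0 i| <= `|x|.
Proof.
rewrite [leRHS]/Num.Def.normr /= mx_normrE.
exact: (le_bigmax 0 (fun ij : 'I_1 * 'I_n => `|x ij.1 ij.2|) (ord0, i)).
Qed.

(** With [norm_le_edist], this transfers compactness and continuity between the
Euclidean distance and the sup norm, which carries the topology. *)
Lemma edist_le_norm x y : edist x y <= n%:R * `|x - y|.
Proof.
rewrite -(ler_pXn2r (n := 2)) ?nnegrE ?sqrtr_ge0 ?mulr_ge0//.
rewrite sqr_sqrtr ?sum_sqr_ge0// exprMn.
apply: (@le_trans _ _ (n%:R * `|x - y| ^+ 2)).
  rewrite mulr_natl -[n in _ *+ n]card_ord -sumr_const.
  apply: ler_sum => i _; rewrite -[leLHS]real_normK ?num_real//.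
  by apply: lerXn2r; rewrite ?nnegrE//; have := coord_le_norm (x - y) i; rewrite !mxE.
apply: ler_wpM2r; first exact: sqr_ge0.
by rewrite -natrX ler_nat; case: (n) => // k; rewrite leq_pmulr.
Qed.

Lemma norm_le_edist x y : `|x - y| <= edist x y.
Proof.
rewrite [leLHS]/Num.Def.normr /= mx_normrE; apply/bigmax_leP; split; first exact: edist_ge0.
move=> [i j] _ /=; rewrite (ord1 i) !mxE -sqrtr_sqr ler_wsqrtr// (bigD1 j)//= lerDl.
by apply: sumr_ge0 => k _; exact: sqr_ge0.
Qed.

Lemma edist_gt0 x y : x <> y -> 0 < edist x y.
Proof.
move=> xy; apply: lt_le_trans (norm_le_edist x y).
by rewrite normr_gt0 subr_eq0; apply/eqP.
Qed.

Lemma edist0_eq x y : edist x y <= 0 -> x = y.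
Proof. by move=> xy0; apply: contrapT => /edist_gt0; rewrite ltNge xy0. Qed.

Lemma compact_edist_bounded A : compact A ->
  exists D, forall x y, A x -> A y -> edist x y <= D.
Proof.
move=> /compact_bounded [N [_ AN]]; exists (n%:R * (2 * (N + 1))) => x y Ax Ay.
apply: le_trans (edist_le_norm x y) _; apply: ler_wpM2l => //.
have {}AN w : A w -> `|w| <= N + 1 by apply: AN; rewrite ltrDl.
by have := ler_normB x y; have := AN x Ax; have := AN y Ay; lra.
Qed.

Lemma compact_sequence_cluster A (u : nat -> 'rV[R]_n) :
  compact A -> (forall k, A (u k)) ->
  exists2 p, A p & forall (e : R) N, 0 < e -> exists2 k, (N <= k)%N & edist p (u k) < e.
Proof.
move=> cA Au; have FA : (u @ \oo) A by exists 0%N => // k _; exact: Au.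
have [p [Ap clp]] := cA _ _ FA.
exists p => // e N e0.
have d0 : 0 < e / n.+1%:R by rewrite divr_gt0.
have [|_ [[k Nk <-] /=]] := clp (u @` [set k | (N <= k)%N]) _ _ (nbhsx_ballx p _ d0).
  by exists N => // k Nk; exists k.
rewrite -ball_normE /= => pk; exists k => //.
apply: le_lt_trans (edist_le_norm _ _) _.
apply: (@le_lt_trans _ _ (n.+1%:R * `|p - u k|)); first by rewrite ler_wpM2r// ler_nat.
by rewrite mulrC -ltr_pdivlMr.
Qed.

Lemma lipschitz_over_gt0 A (f : 'rV[R]_n -> 'rV[R]_n) : lipschitz_over A f ->
  exists2 L : R, 0 < L & forall x y, A x -> A y -> edist (f x) (f y) <= L * edist x y.
Proof.
move=> [L fL]; exists (`|L| + 1) => [|x y Ax Ay]; first by rewrite ltr_pwDr.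
apply: le_trans (fL x y Ax Ay) _; rewrite ler_wpM2r ?edist_ge0//.
by rewrite (le_trans (ler_norm L))// lerDl.
Qed.

Lemma lipschitz_within_continuous A (f : 'rV[R]_n -> 'rV[R]_n) :
  lipschitz_over A f -> {within A, continuous f}.
Proof.
move=> /lipschitz_over_gt0[L L0 fL]; apply/subspace_continuousP => x Ax.
apply/cvgrPdist_lt => e e0.
have Ln0 : 0 < L * n.+1%:R by rewrite mulr_gt0.
have d0 : 0 < e / (L * n.+1%:R) by rewrite divr_gt0.
rewrite near_withinE; apply: filterS (nbhsx_ballx x _ d0) => y.
rewrite -ball_normE /= => xy Ay.
rewrite ltr_pdivlMr// mulrC in xy; apply: le_lt_trans xy.
apply: le_trans (norm_le_edist _ _) _; apply: le_trans (fL _ _ Ax Ay) _.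
rewrite -mulrA ler_wpM2l ?(ltW L0)//; apply: le_trans (edist_le_norm x y) _.
by rewrite ler_wpM2r// ler_nat.
Qed.

End EuclideanDistance.

(** * Comparison of points with a common word *)

Section CodedPairs.
Context {R : realType} {n m : nat}.
Implicit Types (S : zipper_Rn R n m) (K : set 'rV[R]_n) (x y : 'rV[R]_n).

(** The vertex z_0 or z_m; indexing both by a boolean lets the signature act on
them by exclusive or. *)
Definition endpoint S (b : bool) : 'rV[R]_n :=
  vertex S (if b then ord_max else ord0).

Lemma zmap_endpoint S i b :
  zmap S i (endpoint S b) = vertex S (inord (i + (b (+) signature S i))).
Proof.
by case: b; rewrite /endpoint (zmap_first, zmap_last); congr (vertex S (inord _));
  case: (signature S i) => /=; lia.
Qed.

(** The metric content of bounded turning that the comparison uses: the pieces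
S_i(K) are apart unless consecutive, consecutive pieces meet at their common
vertex with a definite angle, and an endpoint of the arc is apart from all
pieces but its own. *)
Record spread S K (c D : R) : Prop := Spread {
  spread_gap_gt0 : 0 < c;
  spread_image : forall i x, K x -> K (zmap S i x);
  spread_cover : forall x, K x -> exists i x', K x' /\ x = zmap S i x';
  spread_vertex : forall i, K (vertex S i);
  spread_bounded : forall x y, K x -> K y -> edist x y <= D;
  spread_far : forall (i j : 'I_m) x y, (i.+1 < j)%N -> K x -> K y ->
    c <= edist (zmap S i x) (zmap S j y);
  spread_adjacent : forall (i j : 'I_m) x y, j = i.+1 :> nat -> K x -> K y ->
    c * edist (zmap S i x) (vertex S (inord j)) <= edist (zmap S i x) (zmap S j y) /\
    c * edist (vertex S (inord j)) (zmap S j y) <= edist (zmap S i x) (zmap S j y);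
  spread_end : forall (i : 'I_m) b x, K x -> i <> (if b then m.-1 else 0%N) :> nat ->
    c <= edist (zmap S i x) (endpoint S b)
}.

Lemma spread_diameter_ge0 S K c D : spread S K c D -> 0 <= D.
Proof.
move=> sK; have K0 := spread_vertex sK ord0.
exact: le_trans (edist_ge0 _ _) (spread_bounded sK K0 K0).
Qed.

(** The words are left implicit: it suffices to know that one exists. *)
Fixpoint same_word S S' K K' (k : nat) x y : Prop :=
  if k is k'.+1 then
    exists i x' y',
      [/\ same_word S S' K K' k' x' y', x = zmap S i x' & y = zmap S' i y']
  else K x /\ K' y.

Lemma same_word_sym S S' K K' k x y :
  same_word S S' K K' k x y -> same_word S' S K' K k y x.
Proof.
elim: k x y => [|k IH] x y /=; first by case.
by move=> [i [x' [y' [w -> ->]]]]; exists i, y', x'; split=> //; exact: IH.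
Qed.

Lemma same_word_mem S S' K K' c D c' D' k x y :
  spread S K c D -> spread S' K' c' D' -> same_word S S' K K' k x y -> K x /\ K' y.
Proof.
move=> sK sK'; elim: k x y => [//|k IH] x y /= [i [x' [y' [/IH[Kx Ky] -> ->]]]].
by split; [exact: spread_image sK _ _ _|exact: spread_image sK' _ _ _].
Qed.

Lemma same_word_le S S' K K' c D c' D' k l x y :
  spread S K c D -> spread S' K' c' D' -> (k <= l)%N ->
  same_word S S' K K' l x y -> same_word S S' K K' k x y.
Proof.
move=> sK sK'; elim: k l x y => [|k IH] l x y kl w.
  exact: same_word_mem sK sK' w.
case: l kl w => // l kl [i [x' [y' [w -> ->]]]].
by exists i, x', y'; split=> //; exact: IH w.
Qed.

Lemma same_word_total S S' K K' c D k x :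
  spread S K c D -> K' !=set0 -> K x -> exists y, same_word S S' K K' k x y.
Proof.
move=> sK [y0 Ky0]; elim: k x => [|k IH] x Kx; first by exists y0.
have [i [x' [Kx' ->]]] := spread_cover sK Kx; have [y w] := IH _ Kx'.
by exists (zmap S' i y), i, x', y.
Qed.

(** The induction step shared by the two estimates: a map of ratio l <= rho applied
on both sides gains a factor rho in the error term. *)
Lemma estimate_scale (l rho C E u v : R) k : 0 < l <= rho -> 0 <= E ->
  v <= C * u + E * rho ^+ k -> l * v <= C * (l * u) + E * rho ^+ k.+1.
Proof.
move=> /andP[l0 lrho] E0 uv; apply: le_trans (ler_wpM2l (ltW l0) uv) _.
rewrite mulrDr exprS; apply: lerD; first by rewrite mulrCA.
rewrite mulrCA ler_wpM2l// ler_wpM2r// exprn_ge0//.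
exact: ltW (lt_le_trans l0 lrho).
Qed.

(** If the first letter of the word is not that of the endpoint, the distance on
the right is bounded below.  Otherwise endpoint and points all lie in the image of
one map, which maps some endpoint to the given one: the estimate for the rest of
the word is rescaled. *)
Lemma endpoint_estimate S S' K K' c D c' D' rho k b x y :
  signature S = signature S' -> (forall i, Lip S i = Lip S' i) ->
  spread S K c D -> spread S' K' c' D' -> (forall i, Lip S i <= rho) ->
  same_word S S' K K' k x y ->
  edist x (endpoint S b) <= D / c' * edist y (endpoint S' b) + D * rho ^+ k.
Proof.
move=> sig lip sK sK' lip_rho.
have D0 := spread_diameter_ge0 sK; have c'0 := spread_gap_gt0 sK'.
have C0 : 0 <= D / c' by rewrite divr_ge0// ltW.
elim: k b x y => [|k IH] b x y.
  move=> [Kx Ky]; rewrite expr0 mulr1 -[leLHS]add0r.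
  apply: lerD; first by rewrite mulr_ge0// edist_ge0.
  exact: spread_bounded sK _ _ Kx (spread_vertex sK _).
have rho0 (i : 'I_m) j : 0 <= rho ^+ j.
  by apply: exprn_ge0; have := lip_rho i; have := Lip_itv S i; lra.
move=> [i [x' [y' [w -> ->]]]]; have [Kx Ky] := same_word_mem sK sK' w.
have [iE|iN] := eqVneq (i : nat) (if b then m.-1 else 0%N); last first.
  apply: (@le_trans _ _ D).
    exact: spread_bounded sK _ _ (spread_image sK i Kx) (spread_vertex sK _).
  have dist_end : c' <= edist (zmap S' i y') (endpoint S' b).
    by apply: spread_end sK' _ _ _ Ky _; exact/eqP.
  rewrite -[leLHS]addr0; apply: lerD; last by rewrite mulr_ge0// (rho0 i).
  by rewrite -mulrA ler_peMr// mulrC ler_pdivlMr// mul1r.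
have endE (T : zipper_Rn R n m) : signature T = signature S ->
    endpoint T b = zmap T i (endpoint T (b (+) signature S i)).
  move=> sT; rewrite zmap_endpoint sT /endpoint addbK; congr (vertex T _).
  apply: val_inj; rewrite /= inordK ?iE; case: b {IH} iE => /=; have := ltn_ord i; lia.
rewrite endE// (endE S')// !zmap_similarity -lip.
apply: estimate_scale (IH _ _ _ w) => //.
by rewrite lip_rho; have /andP[->] := Lip_itv S i.
Qed.

(** The common prefix is rescaled away.  At the first distinct letters, distant
pieces give the constant D / c', and consecutive ones give C / c' for each of the
two distances to the common vertex, where C = D / c' comes from
[endpoint_estimate]. *)
Lemma separation_estimate S S' K K' c D c' D' rho k x1 x2 y1 y2 :
  signature S = signature S' -> (forall i, Lip S i = Lip S' i) ->
  spread S K c D -> spread S' K' c' D' -> (forall i, Lip S i <= rho) ->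
  same_word S S' K K' k x1 y1 -> same_word S S' K K' k x2 y2 ->
  edist x1 x2 <= (D / c' + 2 * (D / c') / c') * edist y1 y2 + 2 * D * rho ^+ k.
Proof.
move=> sig lip sK sK' lip_rho.
have D0 := spread_diameter_ge0 sK; have c'0 := spread_gap_gt0 sK'.
set C := D / c'; have C0 : 0 <= C by rewrite divr_ge0// ltW.
have C20 : 0 <= 2 * C / c' by apply: divr_ge0; [exact: mulr_ge0|exact: ltW].
have rho0 (i : 'I_m) j : 0 <= rho ^+ j.
  by apply: exprn_ge0; have := lip_rho i; have := Lip_itv S i; lra.
elim: k x1 x2 y1 y2 => [|k IH] x1 x2 y1 y2.
  move=> [Kx1 Ky1] [Kx2 Ky2]; rewrite expr0 mulr1.
  have := spread_bounded sK Kx1 Kx2.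
  have : 0 <= (C + 2 * C / c') * edist y1 y2 by rewrite mulr_ge0 ?addr_ge0 ?edist_ge0.
  lra.
move=> [i [x1' [y1' [w1 -> ->]]]] [j [x2' [y2' [w2 -> ->]]]].
wlog ij : i j x1' y1' x2' y2' w1 w2 / (i <= j)%N.
  move=> H; have [|ji] := leqP i j; first exact: H.
  by rewrite edistC [X in _ * X]edistC; apply: H => //; exact: ltnW.
have [Kx1 Ky1] := same_word_mem sK sK' w1; have [Kx2 Ky2] := same_word_mem sK sK' w2.
have [l0 _] := andP (Lip_itv S i).
have [ijE|ijN] := eqVneq i j.
  rewrite -ijE !zmap_similarity -lip.
  by apply: estimate_scale (IH _ _ _ _ w1 w2) => //; rewrite ?l0 ?mulr_ge0//=.
have {ij ijN} ij : (i < j)%N by rewrite ltn_neqAle ij andbT.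
have [far|] := ltnP i.+1 j.
  have far' := spread_far sK' far Ky1 Ky2.
  have := spread_bounded sK (spread_image sK i Kx1) (spread_image sK j Kx2).
  have : D <= C * edist (zmap S' i y1') (zmap S' j y2').
    by rewrite -mulrA ler_peMr// mulrC ler_pdivlMr// mul1r.
  have : 0 <= 2 * C / c' * edist (zmap S' i y1') (zmap S' j y2').
    by rewrite mulr_ge0 ?edist_ge0.
  have : 0 <= D * rho ^+ k.+1 by rewrite mulr_ge0// (rho0 i).
  lra.
move=> ji; have {}ij : j = i.+1 :> nat by apply/eqP; rewrite eqn_leq ij ji.
have [adj1 adj2] := spread_adjacent sK' ij Ky1 Ky2.
(* The common vertex, as the end of piece i and as the beginning of piece j. *)
have jE1 (T : zipper_Rn R n m) : signature T = signature S ->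
    vertex T (inord j) = zmap T i (endpoint T (~~ signature S i)).
  by move=> sT; rewrite zmap_endpoint sT addNb addbb addn1 ij.
have jE2 (T : zipper_Rn R n m) : signature T = signature S ->
    vertex T (inord j) = zmap T j (endpoint T (signature S j)).
  by move=> sT; rewrite zmap_endpoint sT addbb addn0.
have step (a : 'I_m) b x y : same_word S S' K K' k x y ->
    edist (zmap S a x) (zmap S a (endpoint S b)) <=
    C * edist (zmap S' a y) (zmap S' a (endpoint S' b)) + D * rho ^+ k.+1.
  move=> w; rewrite !zmap_similarity -lip.
  apply: estimate_scale => //; first by rewrite lip_rho; have /andP[->] := Lip_itv S a.
  exact: endpoint_estimate sig lip sK sK' lip_rho w.
have := step i (~~ signature S i) _ _ w1; rewrite -jE1// -jE1// => e1.
have := step j (signature S j) _ _ w2; rewrite -jE2// -jE2// => e2.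
apply: le_trans (edist_triangle (vertex S (inord j)) _ _) _.
rewrite [X in _ + X <= _]edistC.
set d := edist (zmap S' i y1') (zmap S' j y2') in adj1 adj2 *.
have b1 : C * edist (zmap S' i y1') (vertex S' (inord j)) <= C / c' * d.
  by rewrite -mulrA ler_wpM2l// mulrC ler_pdivlMr// mulrC.
have b2 : C * edist (zmap S' j y2') (vertex S' (inord j)) <= C / c' * d.
  by rewrite -mulrA ler_wpM2l// edistC mulrC ler_pdivlMr// mulrC.
have : 0 <= C * d by rewrite mulr_ge0// edist_ge0.
by lra.
Qed.
End CodedPairs.

(** * From the comparison to a bi-Lipschitz isomorphism *)

Section Conjugacy.
Context {R : realType} {n m : nat}.
Implicit Types (S : zipper_Rn R n m) (K : set 'rV[R]_n) (x y : 'rV[R]_n).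

Lemma le_of_geometric_error (a b E rho : R) : 0 < rho < 1 ->
  (forall k, a <= b + E * rho ^+ k) -> a <= b.
Proof.
move=> /andP[rho0 rho1] ab; rewrite leNgt; apply/negP => ba.
have := @cvg_geometric R E rho; rewrite gtr0_norm// => /(_ rho1) cv.
have ab0 : 0 < a - b by rewrite subr_gt0.
have [N _ /(_ N (leqnn N)) /= small] := cvgr0_norm_lt _ cv (a - b) ab0.
by have := ab N; have := ler_norm (E * rho ^+ N); lra.
Qed.

(** For y1 = y2 it says that all partners of a point agree up to E rho^k; as k grows
it becomes a Lipschitz bound. *)
Definition comparable S S' K K' (C E rho : R) : Prop :=
  forall k x1 x2 y1 y2,
    same_word S S' K K' k x1 y1 -> same_word S S' K K' k x2 y2 ->
    edist x1 x2 <= C * edist y1 y2 + E * rho ^+ k.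

(** Instead of an infinite address, y is characterized by its distance to every
point that shares a word of length k with x; for small E rho ^+ k this leaves one
candidate, up to the comparison. *)
Definition same_address S S' K K' (E rho : R) x y : Prop :=
  K' y /\ forall k y', same_word S S' K K' k x y' -> edist y y' <= E * rho ^+ k.

(** Any cluster point of a sequence y_k sharing a word of length k with x will do:
two partners y_k and y_l of the same x are within E rho^k for k <= l, by the
comparison with both points on the side of S equal to x. *)
Lemma same_address_total S S' K K' c D c' D' C E rho x :
  0 < rho < 1 -> compact K' -> 
  spread S K c D -> spread S' K' c' D' -> comparable S' S K' K C E rho ->
  K x -> exists y, same_address S S' K K' E rho x y.
Proof.
move=> rho01 cK' sK sK' cmp Kx.
have K'0 : K' !=set0 by exists (vertex S' ord0); exact: spread_vertex sK' _.
have /choice[u uP] k := same_word_total S' k sK K'0 Kx.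
have [p Kp clp] := compact_sequence_cluster cK' (fun k => (same_word_mem sK sK' (uP k)).2).
exists p; split=> // k y w; apply/ler_addgt0Pr => e e0.
have [l kl pl] := clp e k e0.
have wl := same_word_le sK sK' kl (uP l).
have := cmp _ _ _ _ _ (same_word_sym wl) (same_word_sym w).
rewrite edistxx mulr0 add0r => uly.
by have := edist_triangle (u l) p y; lra.
Qed.

Lemma same_address_lipschitz S S' K K' c D c' D' C E rho x1 x2 y1 y2 :
  0 < rho < 1 -> 
  spread S K c D -> spread S' K' c' D' -> comparable S' S K' K C E rho ->
  K x1 -> K x2 ->
  same_address S S' K K' E rho x1 y1 -> same_address S S' K K' E rho x2 y2 ->
  edist y1 y2 <= C * edist x1 x2.
Proof.
move=> rho01 sK sK' cmp Kx1 Kx2 [Ky1 ad1] [_ ad2].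
apply: (le_of_geometric_error (E := 3 * E) rho01) => k.
have K'0 : K' !=set0 by exists y1.
have [z1 w1] := same_word_total S' k sK K'0 Kx1.
have [z2 w2] := same_word_total S' k sK K'0 Kx2.
have := ad1 _ _ w1; have := ad2 _ _ w2.
have := cmp _ _ _ _ _ (same_word_sym w1) (same_word_sym w2).
have := edist_triangle z1 y1 y2; have := edist_triangle z2 z1 y2.
by rewrite (edistC z2 y2); lra.
Qed.

(** Approximate x by x_k that shares a word with y, and y by y_k that shares a
word with x: the comparison bounds |x - x_k| by C |y_k - y| up to the error. *)
Lemma same_address_inverse S S' K K' c D c' D' C E rho x y z :
  0 < rho < 1 ->
  spread S K c D -> spread S' K' c' D' -> comparable S S' K K' C E rho ->
  0 <= C -> K x ->
  same_address S S' K K' E rho x y -> same_address S' S K' K E rho y z -> z = x.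
Proof.
move=> rho01 sK sK' cmp C0 Kx [Ky adx] [Kz ady]; apply: edist0_eq.
apply: (le_of_geometric_error (E := 2 * E + C * E) rho01) => k.
have K0 : K !=set0 by exists x. have K'0 : K' !=set0 by exists y.
have [y' w] := same_word_total S' k sK K'0 Kx.
have [x' w'] := same_word_total S k sK' K0 Ky.
have := ady _ _ w'; have := cmp _ _ _ _ _ w (same_word_sym w').
have : C * edist y' y <= C * (E * rho ^+ k) by rewrite ler_wpM2l// edistC adx.
have := edist_triangle x' z x; rewrite (edistC x' x).
by lra.
Qed.

(** Prefixing a letter keeps a common word and contracts the error. *)
Lemma same_address_zmap S S' K K' c D c' D' E rho i x y z :
  0 < rho < 1 -> 0 <= E -> (forall i, Lip S' i <= rho) ->
  spread S K c D -> spread S' K' c' D' -> K x ->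
  same_address S S' K K' E rho x y ->
  same_address S S' K K' E rho (zmap S i x) z -> z = zmap S' i y.
Proof.
move=> rho01 E0 lip_rho sK sK' Kx [Ky adx] [Kz adSx]; apply: edist0_eq.
apply: (le_of_geometric_error (E := 2 * E) rho01) => k.
have K'0 : K' !=set0 by exists y.
have [y' w] := same_word_total S' k sK K'0 Kx.
have wi : same_word S S' K K' k.+1 (zmap S i x) (zmap S' i y') by exists i, x, y'.
have := adSx _ _ wi.
have := adx _ _ w.
have := edist_triangle (zmap S' i y') z (zmap S' i y).
rewrite zmap_similarity (edistC y' y) exprS.
have [/andP[rho0 rho1] /andP[l0 l1]] := (rho01, Lip_itv S' i).
have : Lip S' i * edist y y' <= edist y y' by rewrite ler_piMl ?edist_ge0// ltW.
have : E * (rho * rho ^+ k) <= E * rho ^+ k.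
  by rewrite ler_wpM2l// ler_piMl ?exprn_ge0// ltW.
by lra.
Qed.

Lemma bilipschitz_of_comparable S S' K K' c D c' D' C E rho :
  0 < rho < 1 -> 0 <= C -> 0 <= E -> (forall i, Lip S' i <= rho) ->
  compact K -> compact K' ->
  spread S K c D -> spread S' K' c' D' -> 
  comparable S S' K K' C E rho -> comparable S' S K' K C E rho ->
  bilipschitz_isomorphic S S' K K'.
Proof.
move=> rho01 C0 E0 lip_rho cK cK' sK sK' cmp cmp'.
have /choice[f fP] x : exists y, K x -> same_address S S' K K' E rho x y.
  have [Kx|nKx] := pselect (K x); last by exists x.
  by have [y xy] := same_address_total rho01 cK' sK sK' cmp' Kx; exists y.
have /choice[h hP] y : exists x, K' y -> same_address S' S K' K E rho y x.
  have [Ky|nKy] := pselect (K' y); last by exists y.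
  by have [x xy] := same_address_total rho01 cK sK' sK cmp Ky; exists x.
have fK x : K x -> K' (f x) by move=> /fP[].
have hK y : K' y -> K (h y) by move=> /hP[].
have lf : lipschitz_over K f.
  exists C => x1 x2 K1 K2.
  exact: same_address_lipschitz rho01 sK sK' cmp' K1 K2 (fP _ K1) (fP _ K2).
have lh : lipschitz_over K' h.
  exists C => y1 y2 K1 K2.
  exact: same_address_lipschitz rho01 sK' sK cmp K1 K2 (hP _ K1) (hP _ K2).
exists f, h; split => //; last first.
  move=> i x Kx.
  exact: same_address_zmap rho01 E0 lip_rho sK sK' Kx (fP _ Kx) (fP _ (spread_image sK i Kx)).
split => //; [split| |].
- move=> x Kx.
  exact: same_address_inverse rho01 sK sK' cmp C0 Kx (fP _ Kx) (hP _ (fK _ Kx)).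
- move=> y Ky.
  exact: same_address_inverse rho01 sK' sK cmp' C0 Ky (hP _ Ky) (fP _ (hK _ Ky)).
- exact: lipschitz_within_continuous.
- exact: lipschitz_within_continuous.
Qed.

Lemma exists_contraction_bound (r : 'I_m -> R) : (forall i, 0 < r i < 1) ->
  exists2 rho : R, 0 < rho < 1 & forall i, r i <= rho.
Proof.
move=> r01; exists (\big[Num.max/2^-1]_i r i); last by move=> i; exact: le_bigmax.
have half0 : 0 < 2^-1 :> R by rewrite invr_gt0.
rewrite (lt_le_trans half0 (bigmax_ge_id _ _ _ _))/=.
by apply: bigmax_lt => [|i _]; [lra|case/andP: (r01 i)].
Qed.

Lemma bilipschitz_of_spread S S' K K' c D c' D' :
  signature S = signature S' -> (forall i, Lip S i = Lip S' i) ->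
  compact K -> compact K' -> spread S K c D -> spread S' K' c' D' ->
  bilipschitz_isomorphic S S' K K'.
Proof.
move=> sig lip cK cK' sK sK'.
have [rho rho01 lip_rho] := exists_contraction_bound (Lip_itv S').
have D0 := spread_diameter_ge0 sK; have c'0 := spread_gap_gt0 sK'.
have D'0 := spread_diameter_ge0 sK'; have c0 := spread_gap_gt0 sK.
have lip_rho' i : Lip S i <= rho by rewrite lip.
set C1 := D / c' + 2 * (D / c') / c'; set C2 := D' / c + 2 * (D' / c) / c.
have pos (a b : R) : 0 <= a -> 0 < b -> 0 <= a / b + 2 * (a / b) / b.
  by move=> a0 /ltW b0; rewrite addr_ge0// !(divr_ge0, mulr_ge0).
have C10 : 0 <= C1 := pos _ _ D0 c'0; have C20 : 0 <= C2 := pos _ _ D'0 c0.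
have weaken C C' E E' (a d : R) k : 0 <= C' -> 0 <= E' -> 0 <= d ->
    a <= C * d + E * rho ^+ k -> a <= (C + C') * d + (E + E') * rho ^+ k.
  move=> C'0 E'0 d0 ad; apply: le_trans ad _.
  have /andP[/ltW rho0 _] := rho01.
  by rewrite lerD// ler_wpM2r ?exprn_ge0// lerDl.
apply: (@bilipschitz_of_comparable S S' K K' c D c' D' (C1 + C2) (2 * D + 2 * D') rho) => //.
- exact: addr_ge0.
- by rewrite addr_ge0// mulr_ge0.
- move=> k x1 x2 y1 y2 w1 w2; apply: weaken; rewrite ?edist_ge0 ?mulr_ge0//.
  exact: separation_estimate sig lip sK sK' lip_rho' w1 w2.
- move=> k y1 y2 x1 x2 w1 w2; rewrite (addrC C1) (addrC (2 * D)).
  apply: weaken; rewrite ?edist_ge0 ?mulr_ge0//.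
  exact: separation_estimate (esym sig) (fun i => esym (lip i)) sK' sK lip_rho w1 w2.
Qed.
End Conjugacy.

(** * Linear zippers *)

Section LinearZippers.
Context {R : realType} {m : nat} (T : zipper (@rdist R) m).
Hypothesis linT : is_linear T.

Lemma linear_vertex_le i j : (i <= j <= m)%N ->
  vertex T (inord i) <= vertex T (inord j).
Proof.
move=> /andP[]; rewrite leq_eqVlt => /orP[/eqP -> //|ij jm].
case: linT => _ _ incr; apply/ltW/incr; rewrite !inordK//; lia.
Qed.

Lemma linear_vertex_lt (i : 'I_m) : vertex T (inord i) < vertex T (inord i.+1).
Proof.
by case: linT => _ _; apply; have im := ltn_ord i; rewrite !inordK; lia.
Qed.

Lemma linear_vertex0 : vertex T (inord 0) = 0.
Proof.
by case: linT => <- _ _; congr (vertex T _); apply: val_inj; rewrite /= inordK.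
Qed.

Lemma linear_vertexm : vertex T (inord m) = 1.
Proof.
by case: linT => _ <- _; congr (vertex T _); apply: val_inj; rewrite /= inordK.
Qed.

Lemma linear_vertex_unit i : unit_itv (vertex T i).
Proof.
rewrite /unit_itv /= in_itv /= -(inord_val i) -{1}linear_vertex0 -linear_vertexm.
by rewrite !linear_vertex_le// ?leqnn; have := ltn_ord i; lia.
Qed.

Lemma linear_Lip i : Lip T i = vertex T (inord i.+1) - vertex T (inord i).
Proof.
case: linT => v0 v1 _; have lt := linear_vertex_lt i.
have := zmap_similarity T i 1 0; have := zmap_first T i; have := zmap_last T i.
rewrite v0 v1 /rdist subr0 normr1 mulr1 => -> ->.
by case: (signature T i); rewrite ?addn1 ?addn0 ?subn0 ?subn1 /=; case: ger0P; lra.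
Qed.

(** The images of the two endpoints determine a similarity of the line: the image
of x is at distances Lip x and Lip (1 - x) from them, hence between them. *)
Lemma linear_zmap i x : unit_itv x ->
  zmap T i x = if signature T i then vertex T (inord i.+1) - Lip T i * x
               else vertex T (inord i) + Lip T i * x.
Proof.
rewrite /unit_itv /= in_itv /= => /andP[x0 x1].
case: linT => v0 v1 _; have lt := linear_vertex_lt i.
have /andP[l0 _] := Lip_itv T i.
have lx0 : 0 <= Lip T i * x by rewrite mulr_ge0// ltW.
have lx1 : 0 <= Lip T i * (1 - x) by rewrite mulr_ge0 ?subr_ge0// ltW.
have := zmap_similarity T i x 0; have := zmap_similarity T i x 1.
have := linear_Lip i.
have := zmap_first T i; have := zmap_last T i; rewrite v0 v1 => -> ->.
have x1E : `|x - 1| = 1 - x by rewrite distrC ger0_norm// subr_ge0.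
rewrite /rdist !subr0 (ger0_norm x0) x1E.
rewrite mulrBr mulr1 in lx1 *.
by case: (signature T i); rewrite ?addn1 ?addn0 ?subn0 ?subn1 /=;
  case: (ger0P (zmap T i x - vertex T (inord i)));
  case: (ger0P (zmap T i x - vertex T (inord i.+1))); lra.
Qed.

(** The signature is the orientation of the map. *)
Lemma linear_zmap_le i x y : unit_itv x -> unit_itv y -> x < y ->
  (zmap T i x <= zmap T i y) = ~~ signature T i.
Proof.
move=> ux uy xy; rewrite !linear_zmap//; have /andP[l0 _] := Lip_itv T i.
case: (signature T i); last by rewrite lerD2l ler_pM2l// ltW.
by rewrite lerD2l lerN2 ler_pM2l// leNgt xy.
Qed.

Lemma linear_zmap_itv (i : 'I_m) x : unit_itv x ->
  vertex T (inord i) <= zmap T i x <= vertex T (inord i.+1).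
Proof.
move=> ux; move: (ux); rewrite /unit_itv /= in_itv /= => /andP[x0 x1].
have /andP[l0 _] := Lip_itv T i.
have lx0 : 0 <= Lip T i * x by rewrite mulr_ge0// ltW.
have lx1 : 0 <= Lip T i * (1 - x) by rewrite mulr_ge0 ?subr_ge0// ltW.
by rewrite linear_zmap// linear_Lip in lx0 lx1 *; case: (signature T i); lra.
Qed.

Lemma linear_zmap_unit i x : unit_itv x -> unit_itv (zmap T i x).
Proof.
move=> /linear_zmap_itv-/(_ i)/andP[ge le].
have := linear_vertex_unit (inord i); have := linear_vertex_unit (inord i.+1).
by rewrite /unit_itv /= !in_itv /= => /andP[? ?] /andP[? ?]; apply/andP; split; lra.
Qed.

(** A single map would have ratio 1. *)
Lemma linear_gt1 : (1 < m)%N.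
Proof.
case: linT => v0 v1 _; rewrite ltnNge; apply/negP => m1.
have := linear_vertexm; have := linear_vertex0.
have [m0|m0] := posnP m; first by rewrite (congr1 (@inord m) m0) => ->; lra.
have m1E : m = 1%N by lia.
have /andP[_] := Lip_itv T (Ordinal m0).
by rewrite linear_Lip /= -(congr1 (@inord m) m1E); lra.
Qed.

End LinearZippers.

(** * Bounded turning and the gaps between pieces *)

Section JordanZippers.
Context {R : realType} {n m : nat}.
Implicit Types (S : zipper_Rn R n m) (K : set 'rV[R]_n) (x y : 'rV[R]_n).

Lemma attractor_image S K : is_attractor S K -> forall i x, K x -> K (zmap S i x).
Proof. by move=> [_ _ KE] i x Kx; rewrite KE; exists i => //; exists x. Qed.

Lemma edist_le_diameter (A K : set 'rV[R]_n) x y :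
  compact K -> A `<=` K -> A x -> A y -> edist x y <= diameter A.
Proof.
move=> /compact_edist_bounded[D KD] AK Ax Ay; apply: ub_le_sup; last by exists x, y.
by exists D => _ [u [v [Au Av ->]]]; apply: KD; exact: AK.
Qed.

(** The subarc from g s to g t contains g u and g v. *)
Lemma turning_parametrization K (g : R -> 'rV[R]_n) :
  compact K -> bounded_turning K -> homeomorphism (@unit_itv R) K g ->
  exists2 M, 0 < M & forall s u v t : R, 0 <= s -> s <= u -> u <= t ->
    s <= v -> v <= t -> t <= 1 -> edist (g u) (g v) <= M * edist (g s) (g t).
Proof.
move=> cK [_ [M M0 turn]] homg; exists M => // s u v t s0 su ut sv vt t1.
have [h [gK _ _ _ _]] := homg.
have inI w : s <= w -> w <= t -> unit_itv w.
  by move=> sw wt; rewrite /unit_itv /= in_itv /=; apply/andP; split; lra.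
have st : s <= t by lra.
have sub : g @` `[s, t] `<=` K.
  by move=> _ [w /= + <-]; rewrite in_itv /= => /andP[sw wt]; apply: gK; exact: inI.
apply: (@le_trans _ _ (diameter (g @` `[s, t]))).
  by apply: (edist_le_diameter cK sub); [exists u|exists v] => //;
    rewrite /= in_itv /=; apply/andP.
apply: turn; [by apply: gK; exact: inI|by apply: gK; exact: inI|].
by exists g, s, t; split => //; rewrite s0 st.
Qed.

Lemma exists_positive_lower_bound (F : 'I_m -> R) : (forall i, 0 < F i) ->
  exists2 e : R, 0 < e <= 1 & forall i, e <= F i.
Proof.
move=> F0; exists (\big[Num.min/1]_i F i); last by move=> i; exact: bigmin_le.
by rewrite bigmin_le_id andbT; apply: lt_bigmin.
Qed.

(** A subarc joining parameters on both sides of a whole interval [t_k, t_(k+1)]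
contains the two distinct vertices z_k and z_(k+1), so bounded turning bounds the
distance of its ends below; this covers both far pieces and endpoints.  For
consecutive pieces, the subarc contains the common vertex. *)
Lemma Jordan_spread S K : is_attractor S K -> is_Jordan S K -> bounded_turning K ->
  exists c D, spread S K c D.
Proof.
move=> attr; have [_ cK KE] := attr; move=> [T [g [linT sigT [gK _ gv gS] homg]]] turnK.
have [M M0 turn] := turning_parametrization cK turnK homg.
have [D KD] := compact_edist_bounded cK.
have [h [_ hK [hg gh] _ _]] := homg.
have gap0 (i : 'I_m) : 0 < edist (vertex S (inord i)) (vertex S (inord i.+1)).
  apply: edist_gt0; rewrite -!gv => /(congr1 h).
  rewrite !hg; [|exact: linear_vertex_unit|exact: linear_vertex_unit].
  by have := linear_vertex_lt linT i => + E; rewrite E ltxx.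
have [e /andP[e0 e1] egap] := exists_positive_lower_bound gap0.
have eM0 : 0 < e / M by rewrite divr_gt0.
have gap (k : 'I_m) s t : 0 <= s -> s <= vertex T (inord k) ->
    vertex T (inord k.+1) <= t -> t <= 1 -> e / M <= edist (g s) (g t).
  move=> s0 sk kt t1; rewrite ler_pdivrMr// mulrC; apply: le_trans (egap k) _.
  have kk := linear_vertex_lt linT k.
  by rewrite -!gv; apply: turn => //; lra.
have vT01 i : 0 <= vertex T i <= 1.
  by have := linear_vertex_unit linT i; rewrite /unit_itv /= in_itv.
have piece (i : 'I_m) x : K x -> exists s, zmap S i x = g s /\
    vertex T (inord i) <= s <= vertex T (inord i.+1).
  move=> Kx; have ux := hK _ Kx; exists (zmap T i (h x)).
  by rewrite -gS// gh//; split => //; exact: linear_zmap_itv.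
exists (e / M), D; split => //.
- exact: attractor_image.
- by move=> x; rewrite {1}KE => -[i _ [y Ky <-]]; exists i, y.
- by move=> i; rewrite -gv; apply: gK; exact: linear_vertex_unit.
- move=> i j x y ij Kx Ky; have im := ltn_ord j.
  have [s [-> /andP[s1 s2]]] := piece i x Kx.
  have [t [-> /andP[t1 t2]]] := piece j y Ky.
  have i1m : (i.+1 < m)%N by lia.
  apply: (gap (Ordinal i1m)) => /=; [|by []| |].
  + by have := vT01 (inord i); lra.
  + by apply: le_trans t1; apply: linear_vertex_le => //; lia.
  + by have := vT01 (inord j.+1); lra.
- move=> i j x y ij Kx Ky.
  have [s [-> /andP[s1 s2]]] := piece i x Kx; rewrite -ij in s2.
  have [t [-> /andP[t1 t2]]] := piece j y Ky.
  have s0 : 0 <= s by have := vT01 (inord i); lra.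
  have t0 : t <= 1 by have := vT01 (inord j.+1); lra.
  have scale (a d : R) : 0 <= d -> a <= M * d -> e / M * a <= d.
    move=> d0 ad; rewrite mulrAC ler_pdivrMr//.
    apply: le_trans (ler_wpM2l (ltW e0) ad) _.
    by rewrite mulrCA mulrC ler_wpM2r ?(ltW M0)// ler_piMl.
  by rewrite -gv; split; apply: scale; rewrite ?edist_ge0//; apply: turn => //; lra.
- move=> i b x Kx ib; have im := ltn_ord i.
  have [s [-> /andP[s1 s2]]] := piece i x Kx.
  have s0 : 0 <= s by have := vT01 (inord i); lra.
  have s3 : s <= 1 by have := vT01 (inord i.+1); lra.
  case: (linT) => v0 v1 _.
  rewrite /endpoint; case: b ib => /= ib; rewrite -gv ?v0 ?v1.
    have mm : (m.-1 < m)%N by lia.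
    apply: (gap (Ordinal mm)) => //=.
      by apply: le_trans s2 _; apply: linear_vertex_le => //; lia.
    by rewrite prednK ?linear_vertexm//; lia.
  rewrite edistC; have m0 : (0 < m)%N by lia.
  apply: (gap (Ordinal m0)) => //=; first by rewrite linear_vertex0.
  by apply: le_trans s1; apply: linear_vertex_le => //; lia.
Qed.

End JordanZippers.

(** * Invariants of bi-Lipschitz isomorphisms *)

Lemma within_continuous_compose (U V W : topologicalType) (A : set U) (B : set V)
    (f : U -> V) (g : V -> W) :
  set_fun A B f -> {within A, continuous f} -> {within B, continuous g} ->
  {within A, continuous (g \o f)}.
Proof.
move=> fAB /subspace_continuousP cf /subspace_continuousP cg.
apply/subspace_continuousP => x Ax N /(cg _ (fAB _ Ax)) gN.
have {gN} : nbhs (f x) (fun y => B y -> N (g y)) := gN.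
move=> /(cf _ Ax) fN; have {fN} : nbhs x (fun z => A z -> B (f z) -> N (g (f z))) := fN.
by apply: filterS => z fz Az; exact: fz Az (fAB _ Az).
Qed.

Lemma inverse_homeomorphisms_sym (U V : topologicalType) (A : set U) (B : set V)
    (f : U -> V) (h : V -> U) :
  inverse_homeomorphisms A B f h -> inverse_homeomorphisms B A h f.
Proof. by case=> fAB hBA [hf fh] cf ch; split. Qed.

Lemma inverse_homeomorphisms_comp (U V W : topologicalType) (A : set U) (B : set V)
    (C : set W) (f : U -> V) (h : V -> U) (f' : V -> W) (h' : W -> V) :
  inverse_homeomorphisms A B f h -> inverse_homeomorphisms B C f' h' ->
  inverse_homeomorphisms A C (f' \o f) (h \o h').
Proof.
move=> [fAB hBA [hf fh] cf ch] [fBC hCB [hf' fh'] cf' ch']; split.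
- by move=> x Ax; apply/fBC/fAB.
- by move=> z Cz; apply/hBA/hCB.
- by split=> [x Ax|z Cz] /=; [rewrite hf' ?hf//; exact: fAB|rewrite fh ?fh'//; exact: hCB].
- exact: within_continuous_compose cf cf'.
- exact: within_continuous_compose ch' ch.
Qed.

Section Isomorphisms.
Context {R : realType} {n m : nat}.
Implicit Types (S : zipper_Rn R n m) (K : set 'rV[R]_n) (x y : 'rV[R]_n).

Lemma agrees_sym S S' K K' (f h : 'rV[R]_n -> 'rV[R]_n) :
  (forall i x, K x -> K (zmap S i x)) -> inverse_homeomorphisms K K' f h ->
  agrees S S' K f -> agrees S' S K' h.
Proof.
move=> KS [_ hK [hf fh] _ _] fS i y Ky.
by rewrite -{1}(fh _ Ky) -fS ?hf//; [exact: KS (hK _ Ky)|exact: hK].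
Qed.

(** Iterating the i-th maps k times gives
Lip S'_i ^ k |f x - f y| <= L Lip S_i ^ k |x - y|; were Lip S_i smaller, letting k
grow would force f x = f y. *)
Lemma lipschitz_agrees_Lip_le S S' K (f : 'rV[R]_n -> 'rV[R]_n) i x y :
  (forall i x, K x -> K (zmap S i x)) -> lipschitz_over K f -> agrees S S' K f ->
  K x -> K y -> f x <> f y -> Lip S' i <= Lip S i.
Proof.
move=> KS [L fL] fS Kx Ky fxy; rewrite leNgt; apply/negP => lt.
have /andP[r0 _] := Lip_itv S i; have /andP[r'0 _] := Lip_itv S' i.
have iterK z k : K z -> K (iter k (zmap S i) z).
  by move=> Kz; elim: k => // k IH; exact: KS.
have f_iter z k : K z -> f (iter k (zmap S i) z) = iter k (zmap S' i) (f z).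
  by move=> Kz; elim: k => //= k IH; rewrite fS ?IH//; exact: iterK.
have iter_sim (T : zipper_Rn R n m) u v k :
    edist (iter k (zmap T i) u) (iter k (zmap T i) v) = Lip T i ^+ k * edist u v.
  by elim: k => [|k IH] /=; rewrite ?expr0 ?mul1r// zmap_similarity IH exprS mulrA.
apply/fxy/edist0_eq.
have ratio01 : 0 < Lip S i / Lip S' i < 1.
  by rewrite divr_gt0// ltr_pdivrMr// mul1r.
apply: (le_of_geometric_error (E := L * edist x y) ratio01) => k.
rewrite add0r expr_div_n mulrA ler_pdivlMr ?exprn_gt0// mulrC -iter_sim -!f_iter//.
by apply: le_trans (fL _ _ _ _) _; rewrite ?iter_sim; [exact: iterK|exact: iterK|lra].
Qed.

(** The map phi read in the parameters is a homeomorphism of [0, 1] conjugating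
T_i to T'_i.  As m >= 2, the first and the last piece are distinct, which excludes
that phi is decreasing; an increasing phi preserves orientations. *)
Lemma conjugate_signature S S' K K' (f h : 'rV[R]_n -> 'rV[R]_n) :
  is_Jordan S K -> is_Jordan S' K' ->
  inverse_homeomorphisms K K' f h -> agrees S S' K f -> signature S = signature S'.
Proof.
move=> [T [g [linT sigT [gK cg gv gS] [g1 homg]]]].
move=> [T' [g' [linT' sigT' [gK' cg' gv' gS'] [g1' homg']]]] homf fS.
have [_ K'01 [g'1g' g'g'1] _ _] := homg'.
have [fK _ _ _ _] := homf.
pose phi : R -> R := g1' \o (f \o g).
have homphi : inverse_homeomorphisms (@unit_itv R) (@unit_itv R) phi (g1 \o h \o g').
  apply: inverse_homeomorphisms_comp (inverse_homeomorphisms_sym homg').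
  exact: inverse_homeomorphisms_comp homg homf.
have [phi01 _ [phiK _] cphi _] := homphi.
have phiT i (x : R) : unit_itv x -> phi (zmap T i x) = zmap T' i (phi x).
  move=> ux; rewrite /phi /= -gS// fS; last exact: gK.
  rewrite -{1}(g'g'1 (f (g x))); last by apply/fK/gK.
  by rewrite gS'; [rewrite g'1g'//; exact/linear_zmap_unit/phi01|exact: phi01].
have u0 : unit_itv (0 : R) by rewrite /unit_itv /= in_itv /= lexx ler01.
have u1 : unit_itv (1 : R) by rewrite /unit_itv /= in_itv /= lexx ler01.
have m1 := linear_gt1 linT; have m0 : (0 < m)%N by lia.
have mm : (m.-1 < m)%N by lia.
have phi_le : phi 0 <= phi 1.
  pose i0 := Ordinal m0; pose im := Ordinal mm.
  (* 0 lies in the first piece of T and 1 in the last one, as images of 0 or 1. *)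
  have [a ua Ta] : exists2 a, unit_itv a & zmap T i0 a = 0.
    exists ((signature T i0)%:R); first by case: (signature T i0).
    rewrite linear_zmap//; last by case: (signature T i0).
    by have := linear_Lip linT i0; rewrite linear_vertex0//; case: (signature T i0) => /=; lra.
  have [b ub Tb] : exists2 b, unit_itv b & zmap T im b = 1.
    exists ((~~ signature T im)%:R); first by case: (signature T im).
    rewrite linear_zmap//; last by case: (signature T im).
    have := linear_Lip linT im; rewrite /= prednK// linear_vertexm//.
    by case: (signature T im) => /=; lra.
  rewrite -Ta -Tb !phiT//.
  have /andP[_ le0] := linear_zmap_itv linT' i0 (phi01 _ ua).
  have /andP[lem _] := linear_zmap_itv linT' im (phi01 _ ub).
  by apply: le_trans le0 (le_trans _ lem); apply: linear_vertex_le => //=; lia.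
have phi_inj : {in `[0, 1] &, injective phi}.
  by move=> x y ux uy E; rewrite -(phiK x)// E phiK.
have phi_mono := segment_continuous_inj_le phi_le cphi phi_inj.
rewrite -sigT -sigT'; apply/ffunP => i; apply: negb_inj.
have phi_lt : phi 0 < phi 1.
  by rewrite lt_neqAle phi_le andbT; apply/eqP => /(congr1 (g1 \o h \o g'));
    rewrite !phiK// => /eqP; rewrite eq_sym oner_eq0.
rewrite -(linear_zmap_le linT i u0 u1 ltr01).
rewrite -(linear_zmap_le linT' i (phi01 _ u0) (phi01 _ u1) phi_lt) -!phiT//.
by rewrite phi_mono//; exact: linear_zmap_unit.
Qed.

(** Pull the ends of a subarc of K' back by h, apply bounded turning of K to the
image arc, and push its diameter forward by f: the constant is L M L'. *)
Lemma bilipschitz_bounded_turning K K' (f h : 'rV[R]_n -> 'rV[R]_n) :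
  compact K -> inverse_homeomorphisms K K' f h ->
  lipschitz_over K f -> lipschitz_over K' h ->
  bounded_turning K -> bounded_turning K'.
Proof.
move=> cK homf /lipschitz_over_gt0[L L0 fL] /lipschitz_over_gt0[L' L'0 hL].
move=> [[g [g1 homg]] [M M0 turn]]; have [fK hK [hf fh] _ _] := homf.
split; first by exists (f \o g), (g1 \o h); exact: inverse_homeomorphisms_comp homg homf.
exists (L * (M * L')); first by rewrite !mulr_gt0.
move=> x y B Kx Ky [phi [s [t [[psi hompsi] [/andP[s0 st] t1] phis phit ->]]]].
have [phiK _ _ _ _] := hompsi.
have sub : phi @` `[s, t] `<=` K'.
  move=> _ [w /= + <-]; rewrite in_itv /= => /andP[sw wt]; apply: phiK.
  by rewrite /unit_itv /= in_itv /=; apply/andP; split; lra.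
have arc : subarc K (h x) (h y) (h @` (phi @` `[s, t])).
  exists (h \o phi), s, t; split; rewrite ?s0 //=; [|by rewrite phis|by rewrite phit|].
    exists (psi \o f); apply: inverse_homeomorphisms_comp hompsi _.
    exact: inverse_homeomorphisms_sym.
  by rewrite image_comp.
have turn_h := turn _ _ _ (hK _ Kx) (hK _ Ky) arc.
apply: ge_sup.
  by exists (edist (phi s) (phi s)), (phi s), (phi s); split => //;
    exists s => //=; rewrite in_itv /= lexx.
move=> _ [u [v [Bu Bv ->]]]; have Ku := sub _ Bu; have Kv := sub _ Bv.
have hsub : h @` (phi @` `[s, t]) `<=` K by move=> _ [w /sub/hK + <-].
rewrite -{1}(fh _ Ku) -{1}(fh _ Kv).
apply: le_trans (fL _ _ (hK _ Ku) (hK _ Kv)) _.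
rewrite -!mulrA ler_wpM2l ?(ltW L0)//.
apply: le_trans (edist_le_diameter cK hsub (imageP h Bu) (imageP h Bv)) _.
by apply: le_trans turn_h _; rewrite ler_wpM2l ?(ltW M0)// hL.
Qed.

Lemma Jordan_nontrivial S K : is_Jordan S K -> exists x y, [/\ K x, K y & x <> y].
Proof.
move=> [T [g [_ _ [gK _ _ _] [h [_ _ [hg _] _ _]]]]].
have u0 : unit_itv (0 : R) by rewrite /unit_itv /= in_itv /= lexx ler01.
have u1 : unit_itv (1 : R) by rewrite /unit_itv /= in_itv /= lexx ler01.
exists (g 0), (g 1); split; [exact: gK|exact: gK|].
by move=> /(congr1 h); rewrite !hg// => /eqP; rewrite eq_sym oner_eq0.
Qed.

Lemma bilipschitz_conjugate_Lip_le S S' K K' (f h : 'rV[R]_n -> 'rV[R]_n) i :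
  is_attractor S K -> is_Jordan S K -> inverse_homeomorphisms K K' f h ->
  agrees S S' K f -> lipschitz_over K f -> Lip S' i <= Lip S i.
Proof.
move=> attr /Jordan_nontrivial[x [y [Kx Ky xy]]] [_ _ [hf _] _ _] fS lf.
apply: (lipschitz_agrees_Lip_le i (attractor_image attr) lf fS Kx Ky).
by move=> /(congr1 h); rewrite !hf.
Qed.

End Isomorphisms.

Theorem theorem2 (R : realType) (n m : nat) (S S' : zipper_Rn R n m)
    (gamma gamma' : set 'rV[R]_n)
    (attrS : is_attractor S gamma) (attrS' : is_attractor S' gamma')
    (JordanS : is_Jordan S gamma) (JordanS' : is_Jordan S' gamma') :
  (signature S = signature S' ->
   (forall i, Lip S i = Lip S' i) ->
   bounded_turning gamma -> bounded_turning gamma' ->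
   bilipschitz_isomorphic S S' gamma gamma') /\
  (bilipschitz_isomorphic S S' gamma gamma' ->
   bounded_turning gamma ->
   [/\ signature S = signature S',
       forall i, Lip S i = Lip S' i
     & bounded_turning gamma']).
Proof.
have [_ cK _] := attrS; have [_ cK' _] := attrS'.
split=> [sig lip turn turn'|[f [h [homf fS lf lh]]] turn].
  have [c [D sK]] := Jordan_spread attrS JordanS turn.
  have [c' [D' sK']] := Jordan_spread attrS' JordanS' turn'.
  exact: bilipschitz_of_spread sig lip cK cK' sK sK'.
have homh := inverse_homeomorphisms_sym homf.
have hS := agrees_sym (attractor_image attrS) homf fS.
split; last exact: bilipschitz_bounded_turning cK homf lf lh turn.
  exact: conjugate_signature JordanS JordanS' homf fS.
move=> i; apply/eqP; rewrite eq_le.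
rewrite (bilipschitz_conjugate_Lip_le i attrS JordanS homf fS lf).
by rewrite (bilipschitz_conjugate_Lip_le i attrS' JordanS' homh hS lh).
Qed.
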